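(* Let $n\ge1$ and let $\mathbf{k}=(k_1,\ldots,k_n)$ be a strictly increasing sequence of positive integers. Let $q=e^{\pi i/8}$ and $$(a_1,b_1,c_1)=(2^{-1/3},2^{1/6},2^{-1/3}),\quad (a_2,b_2,c_2)=q^{3}(2^{1/6},2^{-1/3},2^{-1/3}),\quad (a_3,b_3,c_3)=q^{-3}(2^{1/6},2^{-1/3},2^{-1/3}),$$ and let $$\mathcal{C}_{\mathbf{k}}=b_1^{n(n-1)/2}\,a_2^{n(n-1)/2+nk_n}\,a_3^{n(n+1)/2}.$$ Then there exists a (complex-valued) probabilistic bijection between the set of $20$V configurations on $\mathcal{Q}_{\mathbf{k}}$ with the constant weight function $1$ and the set of mixed six-vertex ($6$V) configurations on $\mathcal{M}_{\mathbf{k}}$ with the weight function $x\mapsto \mathcal{C}_{\mathbf{k}}\cdot\omega_{\mathcal{M}_{\mathbf{k}}}(x)$.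
   Context: **Probabilistic bijections.** Let $X,Y$ be finite sets with weight functions $\omega_X:X\to A$, $\omega_Y:Y\to A$, $A$ a unital algebra (here $A=\mathbb{C}$). A probabilistic bijection from $(X,\omega_X)$ to $(Y,\omega_Y)$ is a pair of maps $\mathcal{P},\overline{\mathcal{P}}:X\times Y\to A$ with (1) $\sum_{y\in Y}\mathcal{P}(x,y)=1$ for each $x\in X$; (2) $\sum_{x\in X}\overline{\mathcal{P}}(x,y)=1$ for each $y\in Y$; (3) $\omega_X(x)\mathcal{P}(x,y)=\overline{\mathcal{P}}(x,y)\omega_Y(y)$ for all $x\in X$, $y\in Y$. **$20$V configurations.** Consider the triangular lattice on $\mathbb{Z}^2$ whose edges are the horizontal and vertical nearest-neighbour edges together with the diagonal edges joining $(i,j)$ and $(i+1,j-1)$. The domain $\mathcal{Q}_{\mathbf{k}}$ has as vertices the lattice points $(i,j)$ with $1\le i\le n$, $j\le k_n$, $i+j\ge 2$. Internal edges have both endpoints in $\mathcal{Q}_{\mathbf{k}}$; boundary edges have exactly one endpoint in $\mathcal{Q}_{\mathbf{k}}$. Incoming/outgoing for a boundary edge is with respect to its endpoint in $\mathcal{Q}_{\mathbf{k}}$. Boundary orientations are fixed: all north boundary edges (other endpoint with second coordinate $k_n+1$) are outgoing; all south boundary edges (boundary edges that are not north, east or west boundary edges) are outgoing; all east boundary edges (other endpoint with first coordinate $n+1$) are incoming; on the west boundary (other endpoint with first coordinate $0$) the horizontal edges at the vertices $(1,k_1),\ldots,(1,k_n)$ are incoming, and the other horizontal edges and all diagonal edges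 are outgoing. A $20$V configuration is an orientation of the internal edges such that every vertex of $\mathcal{Q}_{\mathbf{k}}$ is incident to exactly three incoming and three outgoing edges. **Mixed $6$V configurations.** The domain $\mathcal{M}_{\mathbf{k}}$ in the square lattice $\mathbb{Z}^2$ has vertices $(i,j)$ with $1\le i\le n$ (column $i$) and $1\le j\le 2k_n-1$ (row $j$, counted from the bottom). Internal edges have both endpoints in $\mathcal{M}_{\mathbf{k}}$, boundary edges exactly one. Boundary orientations (with respect to the endpoint in $\mathcal{M}_{\mathbf{k}}$): all north and all south boundary edges are outgoing; all east boundary edges are incoming; on the west boundary the horizontal edges in rows $2k_1-1,\ldots,2k_n-1$ are incoming and all others outgoing. A mixed $6$V configuration is an orientation of the internal edges such that every vertex of $\mathcal{M}_{\mathbf{k}}$ has exactly two incoming and two outgoing edges. Call an edge occupied if it is oriented rightward or downward. The type of a vertex is: (1) all four incident edges occupied; (2) none occupied; (3) exactly the left and right edges occupied; (4) exactly the top and bottom edges occupied; (5) exactly the left and bottom edges occupied; (6) exactly the top and right edges occupied. A vertex in an odd row has weight $a_1$ (types 1,2), $b_1$ (types 3,4), $c_1$ (types 5,6); a vertex in an even row has weight $a_3$ (types 1,2), $b_3$ (types 3,4), $c_3$ (types 5,6). The weight $\omega_{\mathcal{M}_{\mathbf{k}}}(x)$ is the product of the weights of all vertices of $\mathcal{M}_{\mathbf{k}}$. *)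

(* Defs.v *)
From HB Require Import structures.
From mathcomp Require Import all_boot all_order all_algebra.
From mathcomp Require Import finmap complex.
From mathcomp Require Import reals exp trigo.
From mathcomp Require Import zify.

Set Implicit Arguments.
Unset Strict Implicit.
Unset Printing Implicit Defensive.

Import Order.TTheory GRing.Theory Num.Theory.

Local Open Scope fset_scope.
Local Open Scope ring_scope.
Local Open Scope complex_scope.

Definition probabilistic_bijection (A : pzRingType) (X Y : finType)
    (omegaX : X -> A) (omegaY : Y -> A) (P Pbar : X -> Y -> A) : Prop :=
  [/\ forall x, \sum_(y : Y) P x y = 1,
      forall y, \sum_(x : X) Pbar x y = 1
    & forall x y, omegaX x * P x y = Pbar x y * omegaY y].

Definition lattice_point : Type := (int * int)%type.

(* The pair (p, s) encodes the unoriented edge joining p and p + s. The lists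
   of steps used below never contain both s and - s, so each edge has exactly
   one encoding. *)
Definition edge : Type := (lattice_point * lattice_point)%type.

Definition right_step : lattice_point := (1, 0).
Definition up_step : lattice_point := (0, 1).
Definition diag_step : lattice_point := (1, -1).

Definition square_steps : seq lattice_point := [:: right_step; up_step].
Definition triangular_steps : seq lattice_point :=
  [:: right_step; up_step; diag_step].

Definition internal_edges (S : seq lattice_point) (V : {fset lattice_point}) :
    {fset edge} :=
  [fset e in [seq (p, s) | p <- V, s <- S] | (e.1 + e.2 : lattice_point) \in V].

Lemma in_internal_edges (S : seq lattice_point) (V : {fset lattice_point})
    (e : edge) :
  (e \in internal_edges S V) =
  [&& e.2 \in S, e.1 \in V & (e.1 + e.2 : lattice_point) \in V].
Proof.
rewrite !inE /= andbA; congr (_ && _); case: e => p s /=.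
apply/allpairsP/andP => [[[p' s'] /= [pV sS [-> ->]]]|[sS pV]] //.
by exists (p, s).
Qed.

(* Boundary conditions are given by [out v w], which tells whether the boundary
   edge with endpoints v (inside the domain) and w (outside) is outgoing, that
   is, oriented from v to w. *)
Section Orientation.
Variables (S : seq lattice_point) (V : {fset lattice_point}).
Variable out : rel lattice_point.

(* [true] means that the edge (p, s) is oriented from p to p + s. *)
Definition orientation : finType := {ffun internal_edges S V -> bool}.

(* Irrelevant on edges that have no endpoint in V. *)
Definition boundary_forward (e : edge) : bool :=
  if e.1 \in V then out e.1 (e.1 + e.2) else ~~ out (e.1 + e.2) e.1.

Definition forward (o : orientation) (e : edge) : bool :=
  if insub e is Some e' then o e' else boundary_forward e.

Definition outdegree (o : orientation) (v : lattice_point) : nat :=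
  (count (fun s => forward o (v, s)) S
   + count (fun s => ~~ forward o ((v - s)%R, s)) S)%N.

Definition indegree (o : orientation) (v : lattice_point) : nat :=
  (count (fun s => ~~ forward o (v, s)) S
   + count (fun s => forward o ((v - s)%R, s)) S)%N.

Definition balanced (d : nat) (o : orientation) : bool :=
  [forall v : V, (indegree o (val v) == d) && (outdegree o (val v) == d)].

Definition ice_configuration (d : nat) : finType :=
  {o : orientation | balanced d o}.

End Orientation.

Section Domains.
Variables (n : nat) (k : n.-tuple nat).

(* This is k_n when n > 0. *)
Definition k_last : nat := last 0%N k.

(* The enumerated box {1, .., n} x {- n, .., k_n} contains all points with
   1 <= i <= n, j <= k_n and i + j >= 2; see [in_domain20V]. *)
Definition domain20V : {fset lattice_point} :=
  [fset p in [seq (i%:Z, j%:Z - n%:Z) | i <- iota 1 n,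
                                        j <- iota 0 (n + k_last + 1)%N]
   | 2 <= p.1 + p.2].

Lemma in_domain20V (i j : int) :
  ((i, j) \in domain20V) = [&& 1 <= i <= n%:Z, j <= k_last%:Z & 2 <= i + j].
Proof.
rewrite !inE; apply/idP/idP.
  case/andP=> /allpairsP [[a b] /=]; rewrite !mem_iota => -[ha hb [-> ->]].
  by lia.
case/and3P=> h1 h2 h3; apply/andP; split=> //.
apply/allpairsP; exists (`|i|%N, absz (j + n%:Z)) => /=.
by rewrite !mem_iota; split; [lia|lia|congr (_, _); lia].
Qed.

(* Cases, in order: north, east, west, south. A north edge that is also a west
   edge is outgoing by both rules. *)
Definition out20V : rel lattice_point := fun v w =>
  if w.2 == k_last%:Z + 1 then true
  else if w.1 == n%:Z + 1 then false
  else if w.1 == 0 then ~~ ((w.2 == v.2) && (v.2 \in [seq l%:Z | l <- k]))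
  else true.

Definition config20V : finType :=
  ice_configuration triangular_steps domain20V out20V 3.

Definition domain_mixed6V : {fset lattice_point} :=
  [fset p in [seq (i%:Z, j%:Z) | i <- iota 1 n,
                                j <- iota 1 (2 * k_last - 1)%N]].

Lemma in_domain_mixed6V (i j : int) :
  ((i, j) \in domain_mixed6V) =
  (1 <= i <= n%:Z) && (1 <= j <= 2 * k_last%:Z - 1).
Proof.
rewrite !inE; apply/idP/idP.
  by case/allpairsP=> [[a b] /=]; rewrite !mem_iota => -[ha hb [-> ->]]; lia.
case/andP=> h1 h2; apply/allpairsP; exists (`|i|%N, `|j|%N) => /=.
by rewrite !mem_iota; split; [lia|lia|congr (_, _); lia].
Qed.

(* Cases, in order: east, west, north or south. *)
Definition out_mixed6V : rel lattice_point := fun v w =>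
  if w.1 == n%:Z + 1 then false
  else if w.1 == 0 then v.2 \notin [seq 2 * l%:Z - 1 | l <- k]
  else true.

Definition config_mixed6V : finType :=
  ice_configuration square_steps domain_mixed6V out_mixed6V 2.

End Domains.

Record weights6V (C : Type) := Weights6V { wa : C; wb : C; wc : C }.

(* The arguments l, r, t, b tell whether the left, right, top and bottom edges
   are occupied. The last case violates the ice rule, hence never occurs. *)
Definition vertex_weight (C : pzRingType) (w : weights6V C)
    (l r t b : bool) : C :=
  match l, r, t, b with
  | true,  true,  true,  true
  | false, false, false, false => wa w
  | true,  true,  false, false
  | false, false, true,  true  => wb w
  | true,  false, false, true
  | false, true,  true,  false => wc w
  | _, _, _, _ => 0
  end.

Section Weights.
Variable R : realType.

Definition root16 : R[i] := cos (pi / 8) +i* sin (pi / 8).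

Definition two_pow (x : R) : R[i] := (2 `^ x)%:C.

Definition weights1 : weights6V R[i] :=
  Weights6V (two_pow (- (1 / 3))) (two_pow (1 / 6)) (two_pow (- (1 / 3))).

Definition weights2 : weights6V R[i] :=
  Weights6V (root16 ^+ 3 * two_pow (1 / 6))
            (root16 ^+ 3 * two_pow (- (1 / 3)))
            (root16 ^+ 3 * two_pow (- (1 / 3))).

Definition weights3 : weights6V R[i] :=
  Weights6V (root16 ^- 3 * two_pow (1 / 6))
            (root16 ^- 3 * two_pow (- (1 / 3)))
            (root16 ^- 3 * two_pow (- (1 / 3))).

Variables (n : nat) (k : n.-tuple nat).

(* Occupied means oriented rightward or downward, so a vertical edge
   (p, up_step) is occupied when it is not oriented from p to p + up_step. *)
Definition weight_mixed6V (x : config_mixed6V k) : R[i] :=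
  let fwd := forward (out_mixed6V k) (val x) in
  \prod_(v <- domain_mixed6V k)
    vertex_weight (if odd `|v.2|%N then weights1 else weights3)
      (fwd (v - right_step, right_step)) (fwd (v, right_step))
      (~~ fwd (v, up_step)) (~~ fwd (v - up_step, up_step)).

Definition prefactor : R[i] :=
  wb weights1 ^+ ((n * n.-1)./2)%N
  * wa weights2 ^+ ((n * n.-1)./2 + n * k_last k)%N
  * wa weights3 ^+ ((n * n.+1)./2)%N.

End Weights.

(* Main.v *)
Require Import Defs.
From mathcomp Require Import all_boot all_order all_algebra.
From mathcomp Require Import finmap complex.
From mathcomp Require Import boolp reals exp trigo.
From mathcomp Require Import zify ring.

Set Implicit Arguments.
Unset Strict Implicit.
Unset Printing Implicit Defensive.

Import Order.TTheory GRing.Theory Num.Theory.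

Local Open Scope ring_scope.

(** A probabilistic bijection exists as soon as both sides have the same total
weight: with W that common total, take P(x, y) = omega(y) / W and
Pbar(x, y) = 1 / W ([probabilistic_bijection_of_sum]). If W = 0 there is no 20V
configuration, and there must be no mixed 6V configuration either. This holds
because only even rows carry a phase, the same one at each vertex, so that all
the weights are positive multiples of one nonzero constant.

The equality of the totals is obtained by unravelling. Each 20V vertex is
the meeting point of a horizontal, a vertical and a diagonal line. Moving one of
the lines slightly resolves it into three 6V vertices: vertical-horizontal with
weights 1, horizontal-diagonal with weights 2, vertical-diagonal with weights 3.
At the special point chosen, the three vertices together weigh 1 on each of the
20 local configurations and 0 on the others, whether the vertical line passes to
the left of the horizontal-diagonal crossing ([triangle_before]) or to its right
([triangle_after]). Hence the 20V partition function is that of the resolved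
lattice, and every horizontal-diagonal crossing can be pushed to the right
through all the vertical lines ([column_crossings]). The east boundary is
unoccupied, so each crossing that reaches it contributes the factor a2
([crossings_unoccupied], [crossings_rows20V]). Every vertical line then meets, from
bottom to top, the horizontal lines that start on the south boundary, where it
is occupied and weighs b1 each time, then the lines of the mixed domain, then the
diagonal lines that end on the north boundary, where it is unoccupied and weighs
a3 each time ([rows6V_frozen]). The factors multiply to the prefactor
([rows20V_mixed_rows]).

A partition function is represented by a recursion on columns: a functional
on the list of the states of the lines that cross a given vertical cut. The sum over
the orientations of a domain is brought to this form by summing over the edges
one by one and pulling the weight of a vertex out as soon as its six or four
edges are fixed ([sum_orientations_sweep], [card_config20V], [sum_mixed6V]). *)

(** * Column operators and their unravelling *)

Section Operators.
Variable K : comNzRingType.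
Implicit Types (F : seq bool -> K) (p s : seq bool).

Lemma sum_bool (F : bool -> K) : \sum_(x : bool) F x = F true + F false.
Proof. exact: big_bool. Qed.

(** A state is [true] when the edge is occupied, that is, oriented rightward or
downward. The 20V vertex has the left edges [h] (horizontal) and [d] (diagonal),
the right edges [h'] and [d'], the top edge [t] and the bottom edge [b]; the ice
rule says that as many occupied edges enter it as leave it. *)
Definition weight20V (h d t b d' h' : bool) : K := (h + d + t == d' + h' + b)%N%:R.

Variables w1 w2 w3 : weights6V K.

(** Lines of a column are coded by booleans: [false] for a horizontal line, which
meets the vertical line with weights [w1], and [true] for a diagonal line, which
meets it with weights [w3]. *)
Definition wline (c : bool) := if c then w3 else w1.

(** The action of a vertical line crossing the lines [p], listed from bottom to
top: [s] gives the states on the left, [F] is the partition function of what lies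
on the right as a function of the states there, and [top], [b] are the states of the
ends of the vertical line. The value is 0 when [s] is too short. *)
Fixpoint column6V p (top b : bool) F s : K :=
  match p, s with
  | [::], _ => (top == b)%:R * F [::]
  | c :: p', l :: s' =>
      \sum_(t : bool) \sum_(r : bool) vertex_weight (wline c) l r t b
        * column6V p' top t (fun u => F (r :: u)) s'
  | _, _ => 0
  end.

(** The same for a column of [m] 20V vertices. On the left each vertex receives its
horizontal line below its diagonal line; on the right the order is reversed. *)
Fixpoint column20V (m : nat) (top b : bool) F s : K :=
  match m, s with
  | 0, _ => (top == b)%:R * F [::]
  | m'.+1, h :: d :: s' =>
      \sum_(t : bool) \sum_(d' : bool) \sum_(h' : bool)
        weight20V h d t b d' h'
        * column20V m' top t (fun u => F [:: d', h' & u]) s'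
  | _, _ => 0
  end.

(** The crossing of a horizontal line, at position [i] of the list of states, by the
diagonal line at position [i.+1]; the diagonal line plays the role of the vertical
line of a 6V vertex. *)
Fixpoint crossing (i : nat) F s : K :=
  match i, s with
  | 0, h :: d :: s' =>
      \sum_(d' : bool) \sum_(h' : bool)
        vertex_weight w2 h h' d d' * F [:: d', h' & s']
  | i'.+1, x :: s' => crossing i' (fun u => F (x :: u)) s'
  | _, _ => 0
  end.

(** The crossings at the positions listed in [W], met from left to right. *)
Definition crossings (W : seq nat) F : seq bool -> K := foldr crossing F W.

Lemma eq_column6V p top b F G s :
  (forall u, size u = size p -> F u = G u) ->
  column6V p top b F s = column6V p top b G s.
Proof.
elim: p b F G s => [|c p IH] b F G s eqFG /=; first by rewrite eqFG.
case: s => // l s; apply: eq_bigr => t _; apply: eq_bigr => r _.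
by congr (_ * _); apply: IH => u su; rewrite eqFG //= su.
Qed.

Lemma column6V_scale p top b a F s :
  column6V p top b (fun u => a * F u) s = a * column6V p top b F s.
Proof.
elim: p b F s => [|c p IH] b F s /=; first by rewrite mulrCA.
case: s => [|l s]; first by rewrite mulr0.
rewrite mulr_sumr; apply: eq_bigr => t _.
by rewrite mulr_sumr; apply: eq_bigr => r _; rewrite IH mulrCA.
Qed.

Lemma column6V_add p top b F G s :
  column6V p top b (fun u => F u + G u) s =
  column6V p top b F s + column6V p top b G s.
Proof.
elim: p b F G s => [|c p IH] b F G s /=; first by rewrite mulrDr.
case: s => [|l s]; first by rewrite addr0.
rewrite -big_split; apply: eq_bigr => t _.
by rewrite -big_split; apply: eq_bigr => r _; rewrite IH mulrDr.
Qed.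

Lemma column6V_sum2 p top b (a : bool -> bool -> K) F s :
  column6V p top b (fun u => \sum_(x : bool) \sum_(y : bool)
     a x y * F [:: x, y & u]) s =
  \sum_(x : bool) \sum_(y : bool) a x y
     * column6V p top b (fun u => F [:: x, y & u]) s.
Proof.
under eq_column6V => u _ do rewrite !sum_bool.
by rewrite !column6V_add !column6V_scale !sum_bool.
Qed.

Lemma regroup_before (f1 : bool -> bool -> K) (f3 : bool -> bool -> bool -> K)
    (f2 : bool -> bool -> bool -> bool -> K) (G : bool -> bool -> bool -> K) :
  \sum_(m : bool) \sum_(x : bool) f1 m x *
    (\sum_(t : bool) \sum_(y : bool) f3 m t y *
      (\sum_(d : bool) \sum_(h : bool) f2 x y d h * G t d h)) =
  \sum_(t : bool) \sum_(d : bool) \sum_(h : bool)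
    (\sum_(m : bool) \sum_(x : bool) \sum_(y : bool)
      f1 m x * f3 m t y * f2 x y d h) * G t d h.
Proof. by rewrite !sum_bool /=; ring. Qed.

Lemma regroup_after (f2 : bool -> bool -> K) (f3 : bool -> bool -> bool -> K)
    (f1 : bool -> bool -> bool -> bool -> K) (G : bool -> bool -> bool -> K) :
  \sum_(x : bool) \sum_(y : bool) f2 x y *
    (\sum_(m : bool) \sum_(d : bool) f3 x m d *
      (\sum_(t : bool) \sum_(h : bool) f1 y m t h * G t d h)) =
  \sum_(t : bool) \sum_(d : bool) \sum_(h : bool)
    (\sum_(m : bool) \sum_(x : bool) \sum_(y : bool)
      f2 x y * f3 x m d * f1 y m t h) * G t d h.
Proof. by rewrite !sum_bool /=; ring. Qed.

(** Both resolutions of a 20V vertex into three 6V vertices: the vertical line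
passes before, or after, the crossing of the horizontal and diagonal lines. *)
Hypothesis resolve_before : forall h d t b d' h',
  \sum_(m : bool) \sum_(x : bool) \sum_(y : bool)
    vertex_weight w1 h x m b * vertex_weight w3 d y t m
    * vertex_weight w2 x h' y d' = weight20V h d t b d' h'.

Hypothesis resolve_after : forall h d t b d' h',
  \sum_(m : bool) \sum_(x : bool) \sum_(y : bool)
    vertex_weight w2 h y d x * vertex_weight w3 x d' m b
    * vertex_weight w1 y h' t m = weight20V h d t b d' h'.

Lemma column_crossing0 p top b F x y s :
  column6V [:: false, true & p] top b (crossing 0 F) [:: x, y & s] =
  \sum_(t : bool) \sum_(d' : bool) \sum_(h' : bool)
    weight20V x y t b d' h' * column6V p top t (fun u => F [:: d', h' & u]) s.
Proof.
rewrite /=.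
under eq_bigr => m _ do under eq_bigr => r _ do under eq_bigr => t _ do
  under eq_bigr => r' _ do rewrite column6V_sum2.
rewrite (regroup_before (fun m r => vertex_weight w1 x r m b)
  (fun m t r => vertex_weight w3 y r t m)
  (fun r r' d h => vertex_weight w2 r h r' d)
  (fun t d h => column6V p top t (fun u => F [:: d, h & u]) s)).
by do 3![apply: eq_bigr => ? _]; rewrite resolve_before.
Qed.

Lemma crossing_column0 p top b F x y s :
  crossing 0 (column6V [:: true, false & p] top b F) [:: x, y & s] =
  \sum_(t : bool) \sum_(d' : bool) \sum_(h' : bool)
    weight20V x y t b d' h' * column6V p top t (fun u => F [:: d', h' & u]) s.
Proof.
rewrite /= (regroup_after (fun d h => vertex_weight w2 x h y d)
  (fun d m r => vertex_weight w3 d r m b)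
  (fun h m t r => vertex_weight w1 h r t m)
  (fun t d h => column6V p top t (fun u => F [:: d, h & u]) s)).
by do 3![apply: eq_bigr => ? _]; rewrite resolve_after.
Qed.

Lemma crossing_size i F G s : (forall u, size u = size s -> F u = G u) ->
  crossing i F s = crossing i G s.
Proof.
elim: i F G s => [|i IH] F G [|x s] // eqFG.
  case: s eqFG => //= y s eqFG.
  by do 2![apply: eq_bigr => ? _]; rewrite eqFG.
by apply: IH => u su; rewrite eqFG //= su.
Qed.

Lemma crossing_rcons i F s x : (i.+1 < size s)%N ->
  crossing i (fun u => F (rcons u x)) s = crossing i F (rcons s x).
Proof.
elim: i F s => [|i IH] F [|y s] //=; first by case: s.
by move=> lt_is; rewrite (IH (fun u => F (y :: u))).
Qed.

Lemma crossing_sum2 i (a : bool -> bool -> K) (F : bool -> bool -> seq bool -> K)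
    s :
  crossing i (fun u => \sum_(x : bool) \sum_(y : bool) a x y * F x y u) s =
  \sum_(x : bool) \sum_(y : bool) a x y * crossing i (F x y) s.
Proof.
elim: i F s => [|i IH] F [|z s] /=.
- by rewrite !sum_bool !mulr0 !addr0.
- case: s => [|z' s]; first by rewrite !sum_bool !mulr0 !addr0.
  rewrite !sum_bool. ring.
- by rewrite !sum_bool !mulr0 !addr0.
- exact: (IH (fun x y u => F x y (z :: u))).
Qed.

(** The Yang-Baxter move: a crossing passes through a vertical line, because both
sides are resolutions of the same 20V vertex. *)
Lemma column_crossing p1 p2 top b F s : size s = (size p1 + size p2).+2 ->
  column6V (p1 ++ [:: false, true & p2]) top b (crossing (size p1) F) s =
  crossing (size p1) (column6V (p1 ++ [:: true, false & p2]) top b F) s.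
Proof.
elim: p1 b F s => [|c p1 IH] b F [|x s] // => [|[ss]].
  by case: s => // y s _; rewrite column_crossing0 crossing_column0.
rewrite [LHS]/= [crossing _ _ _]/=.
rewrite (crossing_sum2 _ (fun t r => vertex_weight (wline c) x r t b)
  (fun t r u => column6V (p1 ++ [:: true, false & p2]) top t
                  (fun v => F (r :: v)) u)).
by do 2![apply: eq_bigr => ? _]; rewrite -IH.
Qed.

(** [sorts W p q] says that the crossings [W], performed in turn on lines in the
order [p], are each between a horizontal line and the diagonal line just above it,
and leave the lines in the order [q]. *)
Inductive sorts : seq nat -> seq bool -> seq bool -> Prop :=
| sorts_nil p : sorts [::] p p
| sorts_cons p1 p2 W p : sorts W (p1 ++ [:: true, false & p2]) p ->
    sorts (size p1 :: W) (p1 ++ [:: false, true & p2]) p.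

Lemma sorts_size W p q : sorts W p q -> size p = size q.
Proof. by elim=> // p1 p2 W' q' _ <-; rewrite !size_cat. Qed.

Lemma crossings_size W F G s : (forall u, size u = size s -> F u = G u) ->
  crossings W F s = crossings W G s.
Proof.
elim: W F G s => [|i W IH] F G s eqFG /=; first exact: eqFG.
by apply: crossing_size => u su; apply: IH => v sv; rewrite eqFG ?sv.
Qed.

Lemma column_crossings W p q top b F s : sorts W p q -> size s = size p ->
  column6V p top b (crossings W F) s = crossings W (column6V q top b F) s.
Proof.
move=> pq; elim: pq s => // p1 p2 W' q' _ IH s ss /=.
rewrite column_crossing; last by rewrite ss size_cat /= !addnS.
by apply: crossing_size => u su; rewrite IH // su ss !size_cat.
Qed.

Lemma crossings_shift W x F s :
  crossings (map S W) F (x :: s) = crossings W (fun u => F (x :: u)) s.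
Proof.
elim: W s => //= i W IH s.
by congr (crossing i _ s); apply: funext => u.
Qed.

Lemma sorts_shift W p q x : sorts W p q -> sorts (map S W) (x :: p) (x :: q).
Proof.
elim=> [r|p1 p2 W' r _ IH]; first exact: sorts_nil.
exact: (@sorts_cons (x :: p1)).
Qed.

Lemma crossings_rcons W p q F s x : sorts W p q -> size s = size p ->
  crossings W (fun u => F (rcons u x)) s = crossings W F (rcons s x).
Proof.
move=> pq; elim: pq s => // p1 p2 W' r _ IH s ss /=.
rewrite -crossing_rcons; last by rewrite ss size_cat /= !addnS !ltnS leq_addr.
by apply: crossing_size => u su; rewrite IH // su ss !size_cat.
Qed.

Lemma sorts_rcons W p q x : sorts W p q -> sorts W (rcons p x) (rcons q x).
Proof.
elim=> [r|p1 p2 W' r _]; first exact: sorts_nil.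
by rewrite !rcons_cat; apply: sorts_cons.
Qed.

Lemma sorts_cat W W' p q r : sorts W p q -> sorts W' q r -> sorts (W ++ W') p r.
Proof. by elim=> // p1 p2 W'' q' _ IH /IH; apply: sorts_cons. Qed.

(** The positions of the horizontal-diagonal crossings of a column of [l] vertices. *)
Fixpoint layer (l : nat) : seq nat :=
  if l is l'.+1 then 0%N :: map S (map S (layer l')) else [::].

(** The alternating list of length [m] that starts with [c]. *)
Fixpoint alternate (c : bool) (m : nat) : seq bool :=
  if m is m'.+1 then c :: alternate (~~ c) m' else [::].

Lemma size_alternate c m : size (alternate c m) = m.
Proof. by elim: m c => //= m IH c; rewrite IH. Qed.

Lemma size_layer l : size (layer l) = l.
Proof. by elim: l => //= l IH; rewrite !size_map IH. Qed.

Lemma rcons_alternate c m : rcons (alternate c m) (c (+) odd m) = alternate c m.+1.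
Proof.
elim: m c => [|m IH] c /=; first by rewrite addbF.
by rewrite addbN -addNb IH.
Qed.

Lemma sorts_layer l : sorts (layer l) (alternate false l.*2) (alternate true l.*2).
Proof.
elim: l => [|l IH]; first exact: sorts_nil.
by rewrite doubleS /=; apply: (@sorts_cons [::]); do 2!apply: sorts_shift.
Qed.

(** A column of 20V vertices is a vertical line followed by a layer of crossings. *)
Lemma column20V_resolution l top b F s : size s = l.*2 ->
  column20V l top b F s =
  column6V (alternate false l.*2) top b (crossings (layer l) F) s.
Proof.
elim: l b F s => [|l IH] b F [|x [|y s]] // [ss].
rewrite doubleS [alternate _ _]/= [crossings _ _]/= column_crossing0 /=.
do 3![apply: eq_bigr => ? _]; congr (_ * _); rewrite IH //.
by apply: eq_column6V => u _; rewrite !crossings_shift.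
Qed.

(** The east boundary condition: all the lines are unoccupied. *)
Definition unoccupied s : K := (all negb s)%:R.

(** The 20V partition function of [m] columns, the first of which has [l] vertices.
The next column has one more vertex: a horizontal line comes in from the south
boundary and a diagonal line from the north one, both unoccupied. *)
Fixpoint rows20V (m l : nat) s : K :=
  if m is m'.+1 then
    column20V l false true
      (fun u => rows20V m' l.+1 (false :: rcons u false)) s
  else unoccupied s.

(** The same with all the crossings removed: each vertical line crosses the lines [p]
and those that came in at the previous columns. *)
Fixpoint rows6V (m : nat) p s : K :=
  if m is m'.+1 then
    column6V p false true
      (fun u => rows6V m' (false :: rcons p true) (false :: rcons u false)) s
  else unoccupied s.

(** The sum l + (l + 1) + ... + (l + m - 1). *)
Fixpoint sum_from (m l : nat) : nat :=
  if m is m'.+1 then (l + sum_from m' l.+1)%N else 0%N.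

Lemma crossing_unoccupied i s : (i.+1 < size s)%N ->
  crossing i unoccupied s = wa w2 * unoccupied s.
Proof.
rewrite /unoccupied; elim: i s => [|i IH] [|x s] // si.
  case: s si => //= y s _; rewrite !sum_bool /=.
  by case: x; case: y => /=; ring.
rewrite [crossing _ _ _]/= /unoccupied; case: x si => /= si.
  transitivity (crossing i (fun u => \sum_(x : bool) \sum_(y : bool) 0 * (0 : K)) s).
    by apply: crossing_size => u _; rewrite !sum_bool; ring.
  rewrite (crossing_sum2 i (fun _ _ => 0) (fun _ _ _ => 0)) !sum_bool; ring.
by rewrite IH.
Qed.

Lemma crossings_unoccupied W p q s : sorts W p q -> size s = size p ->
  crossings W unoccupied s = wa w2 ^+ size W * unoccupied s.
Proof.
move=> pq; elim: pq s => [r|p1 p2 W' r _ IH] s ss; first by rewrite mul1r.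
rewrite /= (@crossing_size _ _ (fun u => \sum_(x : bool) \sum_(y : bool)
  (if x && y then wa w2 ^+ size W' else 0) * unoccupied u)); last first.
  move=> u su; rewrite IH; last by rewrite su ss !size_cat.
  by rewrite !sum_bool /=; ring.
rewrite (crossing_sum2 _ (fun x y => if x && y then wa w2 ^+ size W' else 0)
  (fun _ _ => unoccupied)).
rewrite !sum_bool /= crossing_unoccupied; last first.
  by rewrite ss size_cat /= !addnS !ltnS leq_addr.
by rewrite exprS; ring.
Qed.

(** Crossings [W] on the left of the first column, together with those inside the
columns, all move to the east boundary, where each becomes a factor [wa w2]. *)
Lemma crossings_rows20V m l W p s :
  sorts W p (alternate false l.*2) -> size s = l.*2 ->
  crossings W (rows20V m l) s =
  wa w2 ^+ (size W + sum_from m l) * rows6V m p s.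
Proof.
elim: m l W p s => [|m IH] l W p s sW ss.
  have sp : size p = l.*2 by rewrite (sorts_size sW) size_alternate.
  by rewrite addn0 (crossings_unoccupied sW) // ss.
have sp : size p = l.*2 by rewrite (sorts_size sW) size_alternate.
have sWl := sorts_cat sW (sorts_layer l).
(* The layer of the first column joins [W]; the vertical line is crossed first,
   then the whole word acts on the next column, one position higher. *)
set G := fun u => rows20V m l.+1 (false :: rcons u false).
transitivity (column6V p false true (crossings (W ++ layer l) G) s).
  rewrite {2}/crossings foldr_cat -/(crossings _ _) -/(crossings _ _).
  rewrite (column_crossings _ _ _ sW) ?ss //.
  by apply: crossings_size => u su; rewrite /= column20V_resolution // su ss.
rewrite /= -column6V_scale; apply: eq_column6V => u su.
rewrite /G (crossings_rcons (fun v => rows20V m l.+1 (false :: v)) _ sWl) //.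
rewrite -(crossings_shift _ false) (IH l.+1 _ (false :: rcons p true)).
- by rewrite size_map size_cat size_layer addnA.
- have := sorts_shift false (sorts_rcons true sWl).
  have -> : rcons (alternate true l.*2) true = alternate true l.*2.+1.
    by rewrite -rcons_alternate odd_double.
  by rewrite doubleS.
- by rewrite /= size_rcons su sp doubleS.
Qed.

(** The partition function of [m] vertical lines that all cross the lines [p]. *)
Fixpoint mixed_rows m p s : K :=
  if m is m'.+1 then column6V p false true (mixed_rows m' p) s
  else unoccupied s.

(** An unoccupied line met at the occupied bottom end of a vertical line goes
straight. *)
Lemma freeze_bottom p top F s :
  column6V (false :: p) top true F (false :: s) =
  wb w1 * column6V p top true (fun u => F (false :: u)) s.
Proof. by rewrite /= !sum_bool /= !mul0r ?(addr0, add0r). Qed.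

(** So does an unoccupied line met at the unoccupied top end. *)
Lemma freeze_top p b F s : size s = size p ->
  column6V (rcons p true) false b F (rcons s false) =
  wa w3 * column6V p false b (fun u => F (rcons u false)) s.
Proof.
elim: p b F s => [|c p IH] b F [|l s] //.
  move=> _; rewrite /= !sum_bool; case: b => /=.
    by rewrite !(mul0r, mulr0) !addr0.
  by rewrite !(mul0r, mulr0) ?(addr0, add0r).
case=> ss; rewrite /= mulr_sumr; apply: eq_bigr => t _.
by rewrite mulr_sumr; apply: eq_bigr => r _; rewrite IH // mulrCA.
Qed.

Lemma unoccupied_nseq a c s :
  unoccupied (nseq a false ++ s ++ nseq c false) = unoccupied s.
Proof. by rewrite /unoccupied !all_cat !all_nseq !orbT andbT. Qed.

Lemma rcons_nseq (T : Type) c (x : T) : rcons (nseq c x) x = nseq c.+1 x.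
Proof. by elim: c => //= c ->. Qed.

Lemma freeze_bottoms a p top F s :
  column6V (nseq a false ++ p) top true F (nseq a false ++ s) =
  wb w1 ^+ a * column6V p top true (fun u => F (nseq a false ++ u)) s.
Proof.
elim: a F => [|a IH] F; first by rewrite mul1r.
by rewrite [nseq _ _ ++ p]/= [nseq _ _ ++ s]/= freeze_bottom IH exprS mulrA.
Qed.

Lemma freeze_tops c p b F s : size s = size p ->
  column6V (p ++ nseq c true) false b F (s ++ nseq c false) =
  wa w3 ^+ c * column6V p false b (fun u => F (u ++ nseq c false)) s.
Proof.
move=> ss; elim: c F => [|c IH] F.
  by rewrite !cats0 mul1r; apply: eq_column6V => u _; rewrite cats0.
rewrite -!rcons_nseq -!rcons_cat freeze_top; last by rewrite !size_cat !size_nseq ss.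
rewrite IH exprS mulrA; congr (_ * _).
by apply: eq_column6V => u _; rewrite rcons_cat.
Qed.

Lemma rows6V_frozen m a c p s : size s = size p ->
  rows6V m (nseq a false ++ p ++ nseq c true) (nseq a false ++ s ++ nseq c false)
  = wb w1 ^+ sum_from m a * wa w3 ^+ sum_from m c * mixed_rows m p s.
Proof.
elim: m a c s => [|m IH] a c s ss; first by rewrite /= unoccupied_nseq !mul1r.
rewrite [LHS]/= freeze_bottoms freeze_tops //=.
transitivity (wb w1 ^+ a * (wa w3 ^+ c * column6V p false true (fun u =>
    wb w1 ^+ sum_from m a.+1 * wa w3 ^+ sum_from m c.+1 * mixed_rows m p u) s)).
  congr (_ * (_ * _)); apply: eq_column6V => u su.
  by rewrite -IH // !rcons_cat !rcons_nseq.
by rewrite column6V_scale !exprD; ring.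
Qed.

Lemma sum_fromE m l : sum_from m l = (m * l + (m * m.-1)./2)%N.
Proof.
elim: m l => //= m IH l; rewrite IH.
have : odd (m * m.-1) = false by case: m {IH} => //= m; rewrite oddM /= andNb.
have : odd (m.+1 * m) = false by rewrite oddM /= andNb.
by nia.
Qed.

(** The conclusion of the unravelling. Above the [l.*2.+1] lines of the mixed domain,
[rcons s false] has one diagonal line, which ends on the north boundary. *)
Lemma rows20V_mixed_rows m l s : size s = l.*2.+1 ->
  rows20V m l.+1 (rcons s false) =
  wa w2 ^+ ((m * m.-1)./2 + m * l.+1)
  * (wb w1 ^+ (m * m.-1)./2 * wa w3 ^+ (m * m.+1)./2
     * mixed_rows m (alternate false l.*2.+1) s).
Proof.
move=> ss.
rewrite -[rows20V m _ _]/(crossings [::] (rows20V m l.+1) (rcons s false)).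
rewrite (@crossings_rows20V m l.+1 [::] (alternate false l.*2.+2)); first last.
- by rewrite size_rcons ss doubleS.
- by rewrite doubleS; apply: sorts_nil.
rewrite add0n sum_fromE addnC; congr (_ * _).
have := @rows6V_frozen m 0 1 (alternate false l.*2.+1) s.
rewrite /= !cats1 size_alternate !sum_fromE muln0 add0n muln1.
rewrite -[false :: rcons _ _]/(rcons (alternate false l.*2.+1) true).
have {1}-> : true = false (+) odd l.*2.+1 by rewrite /= odd_double.
rewrite rcons_alternate => -> //.
have -> // : (m + (m * m.-1)./2 = (m * m.+1)./2)%N.
by rewrite -divn2 -divnMDl // divn2; congr _./2; case: m => // m; rewrite /=; nia.
Qed.

End Operators.

(** * The special point *)

Section Triangles.
Variable K : comNzRingType.
(** At the special point, [al] = 2^(-1/3) and [be] = 2^(1/6), while [ph] and [ps] are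
the opposite phases of the weights 2 and 3. The phases cancel in a product of the
three weights, and the sum over the inner edges is al * be^2, 2 al^3 or 0. *)
Variables al be ph ps : K.
Hypotheses (ph_ps : ph * ps = 1) (al_be : al * be * be = 1)
  (al_al : al * al * al + al * al * al = 1).

Let w1 := Weights6V al be al.
Let w2 := Weights6V (ph * be) (ph * al) (ph * al).
Let w3 := Weights6V (ps * be) (ps * al) (ps * al).

Let unit_abb : (ph * ps) * (al * be * be) = 1.
Proof. by rewrite ph_ps al_be mulr1. Qed.

Let unit_aaa : (ph * ps) * (al * al * al + al * al * al) = 1.
Proof. by rewrite ph_ps al_al mulr1. Qed.

Lemma triangle_before (h d t b d' h' : bool) :
  \sum_(m : bool) \sum_(x : bool) \sum_(y : bool)
    vertex_weight w1 h x m b * vertex_weight w3 d y t m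
    * vertex_weight w2 x h' y d' = weight20V K h d t b d' h'.
Proof.
rewrite !sum_bool /weight20V.
by case: h; case: d; case: t; case: b; case: d'; case: h' => /=;
  rewrite ?(mul0r, mulr0) ?(add0r, addr0) //;
  (rewrite -[RHS]unit_abb; ring) || (rewrite -[RHS]unit_aaa; ring).
Qed.

Lemma triangle_after (h d t b d' h' : bool) :
  \sum_(m : bool) \sum_(x : bool) \sum_(y : bool)
    vertex_weight w2 h y d x * vertex_weight w3 x d' m b
    * vertex_weight w1 y h' t m = weight20V K h d t b d' h'.
Proof.
rewrite !sum_bool /weight20V.
by case: h; case: d; case: t; case: b; case: d'; case: h' => /=;
  rewrite ?(mul0r, mulr0) ?(add0r, addr0) //;
  (rewrite -[RHS]unit_abb; ring) || (rewrite -[RHS]unit_aaa; ring).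
Qed.

End Triangles.

(** * Sums over edges *)

Section EdgeSums.
Variable K : comNzRingType.
Implicit Types (L : seq edge) (sigma : edge -> bool) (F w : (edge -> bool) -> K).

(** An assignment [sigma] gives a direction to every edge of the plane, [true]
meaning forward; [update] changes it at one edge. *)
Definition update sigma e b : edge -> bool := fun e' => if e' == e then b else sigma e'.

(** The sum of [F] over the assignments that differ from [sigma] on [L] only. *)
Fixpoint edge_sum L F sigma : K :=
  if L is e :: L' then \sum_(b : bool) edge_sum L' F (update sigma e b)
  else F sigma.

Lemma eq_edge_sum L F G sigma :
  (forall sigma', (forall e, e \notin L -> sigma' e = sigma e) ->
     F sigma' = G sigma') ->
  edge_sum L F sigma = edge_sum L G sigma.
Proof.
elim: L sigma => [|e L IH] sigma eqFG /=; first exact: eqFG.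
apply: eq_bigr => b _; apply: IH => sigma' Es'; apply: eqFG => e'.
by rewrite inE negb_or => /andP[ne /Es' ->]; rewrite /update (negPf ne).
Qed.

Lemma edge_sum_indep L w F sigma :
  (forall sigma e b, e \in L -> w (update sigma e b) = w sigma) ->
  edge_sum L (fun s => w s * F s) sigma = w sigma * edge_sum L F sigma.
Proof.
elim: L sigma => [|e L IH] sigma wL //=.
rewrite mulr_sumr; apply: eq_bigr => b _; rewrite IH ?wL ?mem_head //.
by move=> s e' b' e'L; rewrite wL // inE e'L orbT.
Qed.

Lemma edge_sum_cat L1 L2 F sigma :
  edge_sum (L1 ++ L2) F sigma = edge_sum L1 (edge_sum L2 F) sigma.
Proof. by elim: L1 sigma => //= e L IH sigma; apply: eq_bigr => b _; apply: IH. Qed.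

Lemma update_out_of sigma (e : edge) b (v s : lattice_point) :
  e.1 != v -> update sigma e b (v, s) = sigma (v, s).
Proof. by case: e => p t /= pv; rewrite /update xpair_eqE eq_sym (negPf pv). Qed.

Lemma update_into sigma (e : edge) b (v s : lattice_point) :
  e.1 + e.2 != v -> update sigma e b (v - s, s) = sigma (v - s, s).
Proof.
case: e => p t /= ptv; rewrite /update; case: eqP => // -[vp st].
by rewrite -vp -st subrK eqxx in ptv.
Qed.

Lemma update_id sigma e : update sigma e (sigma e) = sigma.
Proof. by apply: funext => e'; rewrite /update; case: eqP => [->|]. Qed.

(** Summing over an edge with the constraint that its value is the one given by
[sigma] amounts to not summing over it. *)
Lemma edge_sum_filter (P : pred edge) L F sigma : uniq L ->
  edge_sum L (fun s => (all (fun e => P e || (s e == sigma e)) L)%:R * F s) sigma =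
  edge_sum (filter P L) F sigma.
Proof.
elim: L sigma => [|e L IH] sigma /=; first by rewrite mul1r.
case/andP=> eL uL; case: ifP => Pe /=.
  apply: eq_bigr => b _; rewrite -IH //; apply: eq_edge_sum => s _.
  congr ((nat_of_bool _)%:R * _); apply: eq_in_all => e' e'L; rewrite /update.
  by case: (e' =P e) => // ee; rewrite ee (negPf eL) in e'L.
have E b : edge_sum L (fun s => ((s e == sigma e)
      && all (fun e0 => P e0 || (s e0 == sigma e0)) L)%:R * F s) (update sigma e b)
    = (b == sigma e)%:R * edge_sum [seq x <- L | P x] F (update sigma e b).
  rewrite -IH // -(@edge_sum_indep _ (fun s => (b == sigma e)%:R)) //.
  apply: eq_edge_sum => s /(_ _ eL); rewrite {1}/update eqxx => ->.
  rewrite mulrA -natrM mulnb; congr (_ * _).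
  congr ((nat_of_bool (_ && _))%:R); apply: eq_in_all => e' e'L; rewrite /update.
  by case: (e' =P e) => // ee; rewrite ee (negPf eL) in e'L.
rewrite sum_bool !E -[in RHS](update_id sigma e).
by case: (sigma e); rewrite ?mul1r ?mul0r ?addr0 ?add0r.
Qed.

(** The assignment [sigma] with the values of [o] on the edges of [E]. *)
Definition override (E : {fset edge}) sigma (o : {ffun E -> bool}) : edge -> bool :=
  fun e => if insub e is Some e' then o e' else sigma e.

(** By induction on [L], for the orientations that agree with [sigma] off [L]. *)
Lemma sum_override (E : {fset edge}) L F sigma :
  uniq L -> {subset L <= E} ->
  \sum_(o : {ffun E -> bool} |
      [forall e : E, (val e \notin L) ==> (o e == sigma (val e))])
    F (override sigma o) = edge_sum L F sigma.
Proof.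
elim: L sigma => [|e L IH] sigma /=.
  move=> _ _; rewrite (big_pred1 [ffun e => sigma (val e)]).
    congr F; apply: funext => e; rewrite /override; case: insubP => //= e' _ <-.
    by rewrite ffunE.
  move=> o; apply/forallP/eqP => [Ho|-> e]; last by rewrite ffunE.
  by apply/ffunP=> e; rewrite ffunE; apply/eqP/Ho.
case/andP=> eL uL sLE; have eE : e \in E by apply: sLE; rewrite mem_head.
have sLE' : {subset L <= E} by move=> x xL; apply: sLE; rewrite inE xL orbT.
rewrite (partition_big (fun o : {ffun E -> bool} => o [` eE]%fset) xpredT) //=.
apply: eq_bigr => b _; rewrite -IH //; apply: eq_big => [o|o].
  apply/andP/forallP => [[/forallP Ho /eqP ob] e'|Ho].
    apply/implyP => e'L; rewrite /update; case: (val e' =P e) => [ee|/eqP ne].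
      by rewrite -ob; apply/eqP; congr (o _); apply: val_inj.
    by have /implyP := Ho e'; apply; rewrite inE negb_or ne.
  split.
    apply/forallP => e'; apply/implyP; rewrite inE negb_or => /andP[ne e'L].
    by have /implyP/(_ e'L) := Ho e'; rewrite /update (negPf ne).
  by have /implyP/(_ eL) := Ho [` eE]%fset; rewrite /update /= eqxx.
case/andP=> _ /eqP ob; congr F; apply: funext => e'; rewrite /override.
case: insubP => // e'E; rewrite /update; case: eqP => // ee.
by rewrite ee eE in e'E.
Qed.

Lemma sum_orientations (S : seq lattice_point) (V : {fset lattice_point})
    (out : rel lattice_point) L F :
  uniq L -> L =i internal_edges S V ->
  \sum_(o : orientation S V) F (forward out o) =
  edge_sum L F (boundary_forward V out).
Proof.
move=> uL EL; rewrite -(@sum_override (internal_edges S V)) //; last by move=> e; rewrite EL.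
apply: eq_big => // o; symmetry; apply/forallP => e.
by rewrite EL (valP e).
Qed.

End EdgeSums.

(** * Sweeping a domain column by column *)

Section Sweep.
Variable K : comNzRingType.
Implicit Types (sigma : edge -> bool) (S : seq lattice_point).

(** A step of a sweep: the edges to sum over, then the weight that these edges and
the previous ones determine. *)
Definition step : Type := (seq edge * ((edge -> bool) -> K))%type.
Implicit Types (st : step) (sts : seq step).

Fixpoint sweep sts sigma : K :=
  if sts is st :: sts' then edge_sum st.1 (fun s => st.2 s * sweep sts' s) sigma
  else 1.

Definition step_edges sts : seq edge := flatten [seq st.1 | st <- sts].

(** The weight of each step does not depend on the edges of the later steps. *)
Fixpoint settled sts : Prop :=
  if sts is st :: sts' then
    (forall sigma e b, e \in step_edges sts' ->
       st.2 (update sigma e b) = st.2 sigma) /\ settled sts'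
  else True.

Lemma sweepE sts sigma : settled sts ->
  sweep sts sigma =
  edge_sum (step_edges sts) (fun s => \prod_(st <- sts) st.2 s) sigma.
Proof.
elim: sts sigma => [|st sts IH] sigma /=; first by rewrite big_nil.
case=> st_sts /IH {}IH; rewrite /step_edges /= edge_sum_cat.
apply: eq_edge_sum => s _; rewrite IH -edge_sum_indep //.
by apply: eq_edge_sum => s' _; rewrite big_cons.
Qed.

Variables (S : seq lattice_point) (w : lattice_point -> (edge -> bool) -> K).
Variables (top : int) (slope : bool).

Hypothesis sub_steps : {subset S <= triangular_steps}.
Hypothesis w_local : forall (v : lattice_point) sigma (e : edge) b,
  e.1 != v -> e.1 + e.2 != v -> w v (update sigma e b) = w v sigma.

(** The [l] points of abscissa [i] with ordinates from [j] upward. *)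
Fixpoint column (i j : int) (l : nat) : seq lattice_point :=
  if l is l'.+1 then (i, j) :: column i (j + 1) l' else [::].

(** [m] successive columns, the first one with [l] points starting at [(i, j)]. All
reach the same height; when [slope] is set, each starts one unit below the previous
one. *)
Fixpoint vertices (i j : int) (l m : nat) : seq lattice_point :=
  if m is m'.+1 then column i j l ++ vertices (i + 1) (j - slope%:Z) (l + slope) m'
  else [::].

(** The edges of [vertex_step v] include boundary edges; [top_step] and a last step
for the east boundary restore the boundary conditions. *)
Definition vertex_step (v : lattice_point) : step := ([seq (v, s) | s <- S], w v).

Definition top_step (i : int) : step :=
  ([::], fun s : edge -> bool => (s ((i, top), up_step))%:R).

Fixpoint column_steps (i j : int) (l m : nat) : seq step :=
  if m is m'.+1 then map vertex_step (column i j l) ++ top_step i ::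
    column_steps (i + 1) (j - slope%:Z) (l + slope) m'
  else [::].

Fixpoint top_outgoing (i : int) (m : nat) sigma : bool :=
  if m is m'.+1 then sigma ((i, top), up_step) && top_outgoing (i + 1) m' sigma
  else true.

Lemma mem_column i j l a b :
  ((a, b) \in column i j l) = (a == i) && (j <= b < j + l%:Z).
Proof.
elim: l j => [|l IH] j /=; first by rewrite in_nil; lia.
by rewrite in_cons IH xpair_eqE; lia.
Qed.

Lemma uniq_column i j l : uniq (column i j l).
Proof. by elim: l j => //= l IH j; rewrite IH mem_column; lia. Qed.

Lemma mem_vertices i j l m a b :
  ((a, b) \in vertices i j l m) =
  (i <= a < i + m%:Z) && (j - (if slope then a - i else 0) <= b < j + l%:Z).
Proof.
elim: m i j l => [|m IH] i j l /=; first by rewrite in_nil; lia.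
by rewrite mem_cat mem_column IH; case: slope; lia.
Qed.

Lemma uniq_vertices i j l m : uniq (vertices i j l m).
Proof.
elim: m i j l => //= m IH i j l; rewrite cat_uniq uniq_column IH andbT /=.
apply/hasPn => -[a b]; rewrite mem_vertices mem_column; lia.
Qed.

Lemma top_outgoingP i m sigma :
  reflect (forall a, i <= a < i + m%:Z -> sigma ((a, top), up_step))
    (top_outgoing i m sigma).
Proof.
elim: m i => [|m IH] i /=; first by left; lia.
apply: (iffP andP) => [[s_i /IH s_m] a am|s_m].
  by have [->//|] := eqVneq a i; move=> ?; apply: s_m; lia.
by split; [apply: s_m; lia | apply/IH => a am; apply: s_m; lia].
Qed.

Lemma column_steps_edges i j l m :
  step_edges (column_steps i j l m) = [seq (v, s) | v <- vertices i j l m, s <- S].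
Proof.
rewrite /step_edges; elim: m i j l => //= m IH i j l.
rewrite map_cat flatten_cat /= IH map_cat flatten_cat; congr (_ ++ _).
by rewrite -map_comp.
Qed.

Lemma column_steps_prod i j l m sigma :
  \prod_(st <- column_steps i j l m) st.2 sigma =
  \prod_(v <- vertices i j l m) w v sigma * (top_outgoing i m sigma)%:R.
Proof.
elim: m i j l => [|m IH] i j l /=; first by rewrite !big_nil mul1r.
rewrite !big_cat big_cons /= IH big_map /=.
by rewrite -mulnb natrM; ring.
Qed.

Lemma step_edges_cat sts1 sts2 :
  step_edges (sts1 ++ sts2) = step_edges sts1 ++ step_edges sts2.
Proof. by rewrite /step_edges map_cat flatten_cat. Qed.

(** Steps go rightward, upward or down to the next column, so no edge that starts
from a later vertex is incident to an earlier one. *)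
Lemma settled_column i j l sts :
  (forall e, e \in step_edges sts -> (i < e.1.1) && (e.2 \in S)) ->
  settled sts -> settled (map vertex_step (column i j l) ++ top_step i :: sts).
Proof.
move=> sts_edges set_sts; elim: l j => [|l IH] j /=.
  split=> // sigma e b /sts_edges /andP[ie _]; rewrite /update.
  by case: eqP => // ee; rewrite -ee /= ltxx in ie.
split=> // sigma [[p1 p2] [s1 s2]] b; rewrite step_edges_cat mem_cat => e_in.
have {e_in} /andP[p_in s_in] : (((i == p1) && (j < p2)) || (i < p1))
    && ((s1, s2) \in S).
  case/orP: e_in => [/flattenP[_ /mapP[_ /mapP[[a c] v_in ->] ->]]|].
    case/mapP=> s sS [-> -> es]; rewrite es sS andbT.
    by move: v_in; rewrite mem_column; lia.
  by rewrite /step_edges /= => /sts_edges /= /andP[-> ->]; rewrite orbT.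
apply: w_local; rewrite /= -pair_eqE /=; first lia.
move: (sub_steps s_in); rewrite !inE -!pair_eqE /=.
by rewrite /GRing.add /=; lia.
Qed.

Lemma settled_column_steps i j l m (T : (edge -> bool) -> K) :
  settled (column_steps i j l m ++ [:: ([::], T)]).
Proof.
elim: m i j l => //= m IH i j l; rewrite -catA; apply: settled_column => //.
move=> [[a b] s]; rewrite step_edges_cat column_steps_edges cats0.
by case/allpairsP=> -[[a' b'] s'] [/=]; rewrite mem_vertices => ? ? [-> _ ->]; lia.
Qed.

(** [Tb] is the boundary condition on the east side. *)
Lemma sum_orientations_sweep (V : {fset lattice_point}) (out : rel lattice_point)
    i j l m (Tb : pred (edge -> bool)) :
  let L := [seq (v, s) | v <- vertices i j l m, s <- S] in
  let bnd := boundary_forward V out in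
  uniq S -> V =i vertices i j l m ->
  (forall sigma, (forall e, e \notin L -> sigma e = bnd e) ->
    all (fun e => (e.1 + e.2 \in V) || (sigma e == bnd e)) L =
    top_outgoing i m sigma && Tb sigma) ->
  \sum_(o : orientation S V) \prod_(v <- V) w v (forward out o) =
  sweep (column_steps i j l m ++ [:: ([::], fun s : edge -> bool => (Tb s)%:R)]) bnd.
Proof.
move=> L bnd uS EV bndT.
have uL : uniq L.
  by apply: allpairs_uniq => // [|[? ?] [? ?] _ _ [-> ->] //]; apply: uniq_vertices.
have EL : [seq e <- L | e.1 + e.2 \in V] =i internal_edges S V.
  move=> [p s]; rewrite mem_filter in_internal_edges /= andbC andbA; congr (_ && _).
  apply/allpairsP/andP=> [[[p' s'] /= [pV sS [-> ->]]]|[sS pV]]; first by rewrite EV.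
  by exists (p, s); rewrite -EV.
rewrite (@sum_orientations _ _ _ _ [seq e <- L | e.1 + e.2 \in V]
  (fun s => \prod_(v <- V) w v s)) ?filter_uniq //.
rewrite -(@edge_sum_filter _ (fun e => e.1 + e.2 \in V)) //.
rewrite sweepE; last exact: settled_column_steps.
rewrite step_edges_cat column_steps_edges cats0.
apply: eq_edge_sum => s s_bnd; rewrite big_cat big_seq1 /= column_steps_prod.
rewrite bndT // -mulnb natrM mulrC !mulrA; congr (_ * _ * _).
apply: perm_big; apply: uniq_perm => //; [exact: fset_uniq|exact: uniq_vertices].
Qed.

End Sweep.

Lemma sub_right (i j : int) : ((i, j) : lattice_point) - right_step = (i - 1, j).
Proof. by congr (_, _); rewrite /= subr0. Qed.

Lemma sub_up (i j : int) : ((i, j) : lattice_point) - up_step = (i, j - 1).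
Proof. by congr (_, _); rewrite /= subr0. Qed.

Lemma sub_diag (i j : int) : ((i, j) : lattice_point) - diag_step = (i - 1, j + 1).
Proof. by congr (_, _); rewrite /= opprK. Qed.

(** * Columns of 20V vertices *)

Section TwentyVertexSide.
Variable K : comNzRingType.
Implicit Types (sigma : edge -> bool).

(** The weight of the 20V vertex [v]; a vertical edge is occupied when it points
downward. *)
Definition local20V (v : lattice_point) sigma : K :=
  weight20V K (sigma (v - right_step, right_step)) (sigma (v - diag_step, diag_step))
    (~~ sigma (v, up_step)) (~~ sigma (v - up_step, up_step))
    (sigma (v, diag_step)) (sigma (v, right_step)).

Lemma local20V_update (v : lattice_point) sigma (e : edge) b :
  e.1 != v -> e.1 + e.2 != v -> local20V v (update sigma e b) = local20V v sigma.
Proof.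
move=> pv psv.
by rewrite /local20V !(update_into _ _ _ psv, update_out_of _ _ _ pv).
Qed.

(** The states of the edges that enter column [i] from the left at the [l] vertices
from [(i, j)] upward. *)
Fixpoint entering (i j : int) (l : nat) sigma : seq bool :=
  if l is l'.+1 then
    [:: sigma ((i - 1, j), right_step), sigma ((i - 1, j + 1), diag_step)
      & entering i (j + 1) l' sigma]
  else [::].

(** The states of the edges that leave these vertices to the right. *)
Fixpoint leaving (i j : int) (l : nat) sigma : seq bool :=
  if l is l'.+1 then
    [:: sigma ((i, j), diag_step), sigma ((i, j), right_step)
      & leaving i (j + 1) l' sigma]
  else [::].

(** The next column meets the same edges in the same order, between one more
horizontal edge and one more diagonal edge. *)
Lemma entering_next i j l sigma :
  entering (i + 1) (j - 1) l.+1 sigma =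
  sigma ((i, j - 1), right_step)
    :: rcons (leaving i j l sigma) (sigma ((i, j + l%:Z), diag_step)).
Proof.
have -> : entering (i + 1) (j - 1) l.+1 sigma =
    [:: sigma ((i, j - 1), right_step), sigma ((i, j), diag_step)
      & entering (i + 1) j l sigma] by rewrite /= addrK subrK.
congr cons; elim: l j => [|l IH] j /=; first by rewrite addr0.
rewrite addrK; congr cons; rewrite IH; congr cons; congr (rcons _ (sigma ((i, _), _))).
by lia.
Qed.

Lemma eq_entering i j l sigma sigma' :
  (forall p s, p.1 = i - 1 -> sigma' (p, s) = sigma (p, s)) ->
  entering i j l sigma' = entering i j l sigma.
Proof. by move=> Es; elim: l j => //= l IH j; rewrite IH !Es. Qed.

Lemma entering_unoccupied i j l sigma :
  reflect (forall a, j <= a < j + l%:Z ->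
     ~~ sigma ((i - 1, a), right_step) && ~~ sigma ((i - 1, a + 1), diag_step))
    (all negb (entering i j l sigma)).
Proof.
elim: l j => [|l IH] j /=; first by left; lia.
rewrite andbA; apply: (iffP andP) => [[s_j /IH s_l] a al|s_l].
  by have [->//|] := eqVneq a j; move=> ?; apply: s_l; lia.
by split; [apply: s_l; lia | apply/IH => a al; apply: s_l; lia].
Qed.

Variable top : int.

Lemma sweep_column20V (i j : int) l sts Phi sigma :
  j + l%:Z = top + 1 ->
  (forall sigma', (forall e : edge, e.1 \notin column i j l -> sigma' e = sigma e) ->
     sweep sts sigma' = Phi (leaving i j l sigma')) ->
  sweep (map (vertex_step triangular_steps local20V) (column i j l)
           ++ top_step K top i :: sts) sigma =
  column20V l false (~~ sigma ((i, j - 1), up_step)) Phi (entering i j l sigma).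
Proof.
elim: l j Phi sigma => [|l IH] j Phi sigma jl sts_Phi.
  rewrite /= sts_Phi //; have -> : j - 1 = top by lia.
  by congr (_ * _); case: (sigma _).
rewrite [column _ _ _]/= [LHS]/= [RHS]/= exchange_big [RHS]sum_bool.
rewrite [LHS]sum_bool addrC.
have cell r u d :
  let s := update (update (update sigma (i, j, right_step) r) (i, j, up_step) u)
             (i, j, diag_step) d in
  local20V (i, j) s * sweep (map (vertex_step triangular_steps local20V)
    (column i (j + 1) l) ++ top_step K top i :: sts) s =
  weight20V K (sigma ((i - 1, j), right_step)) (sigma ((i - 1, j + 1), diag_step))
    (~~ u) (~~ sigma ((i, j - 1), up_step)) d r
  * column20V l false (~~ u) (fun v => Phi [:: d, r & v])
      (entering i (j + 1) l sigma).
  move=> s.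
  have s_other p q : p != (i, j) -> s (p, q) = sigma (p, q).
    by move=> /negPf ne; rewrite /s /update !xpair_eqE ne.
  have s_right : s ((i, j), right_step) = r by rewrite /s /update !xpair_eqE !eqxx.
  have s_up : s ((i, j), up_step) = u by rewrite /s /update !xpair_eqE !eqxx.
  have s_diag : s ((i, j), diag_step) = d by rewrite /s /update !xpair_eqE !eqxx.
  congr (_ * _).
    rewrite /local20V s_right s_up s_diag sub_right sub_diag sub_up.
    by rewrite !s_other // xpair_eqE; lia.
  rewrite (IH _ (fun v => Phi [:: d, r & v])); first last.
  - move=> s' s'E; rewrite sts_Phi /=.
      by rewrite !s'E ?s_right ?s_diag // mem_column; lia.
    by move=> [p q]; rewrite in_cons negb_or => /andP[ne e_in]; rewrite s'E // s_other.
  - by lia.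
  rewrite addrK s_up; congr column20V; apply: eq_entering => p q pi.
  by rewrite s_other //; apply/eqP => pE; move: pi; rewrite pE /=; lia.
by rewrite !sum_bool !cell /=; ring.
Qed.

Lemma sweep_rows20V m (i j : int) l (T : pred (edge -> bool)) sigma :
  j + l%:Z = top + 1 ->
  (forall s, T s = all negb (entering (i + m%:Z) (j - m%:Z) (l + m) s)) ->
  (forall p s : lattice_point,
     i <= p.1 < i + m%:Z -> (p.1 + p.2 == i + j - 1) || (p.2 == top + 1) ->
     sigma (p, s) = false) ->
  sweep (column_steps triangular_steps local20V top true i j l m
           ++ [:: ([::], fun s : edge -> bool => (T s)%:R)]) sigma =
  rows20V K m l (entering i j l sigma).
Proof.
elim: m i j l sigma => [|m IH] i j l sigma jl ET bnd.
  by rewrite /= mulr1 ET addr0 subr0 addn0.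
rewrite [column_steps _ _ _ _ _ _ _ _]/= -catA.
rewrite (sweep_column20V (Phi := fun u => rows20V K m l.+1 (false :: rcons u false))) //.
  by rewrite /= bnd //=; lia.
move=> s' s'E.
have s'_out p s : p.1 = i -> (p.2 == j - 1) || (p.2 == top + 1) ->
    s' (p, s) = false.
  move: p => [a b] /= ai b_out; rewrite s'E; last by rewrite mem_column; lia.
  by rewrite bnd //=; lia.
rewrite addn1 IH; first last.
- move=> [a b] s /= ai b_out; rewrite s'E; last by rewrite mem_column; lia.
  by rewrite bnd //=; lia.
- move=> s; rewrite ET; congr (all _ (entering _ _ _ _)); lia.
- by lia.
by rewrite entering_next !s'_out //=; lia.
Qed.

End TwentyVertexSide.

(** * Columns of mixed 6V vertices *)

Section MixedSide.
Variable K : comNzRingType.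
Variables w1 w3 : weights6V K.
Implicit Types (sigma : edge -> bool).

(** The weight of the 6V vertex [v]: [w1] in odd rows, [w3] in even rows. *)
Definition local6V (v : lattice_point) sigma : K :=
  vertex_weight (if odd `|v.2|%N then w1 else w3)
    (sigma (v - right_step, right_step)) (sigma (v, right_step))
    (~~ sigma (v, up_step)) (~~ sigma (v - up_step, up_step)).

Lemma local6V_update (v : lattice_point) sigma (e : edge) b :
  e.1 != v -> e.1 + e.2 != v -> local6V v (update sigma e b) = local6V v sigma.
Proof.
move=> pv psv.
by rewrite /local6V !(update_into _ _ _ psv, update_out_of _ _ _ pv).
Qed.

(** The states of the [l] horizontal edges that leave column [i] from ordinate [j]
upward. *)
Fixpoint horizontals (i j : int) (l : nat) sigma : seq bool :=
  if l is l'.+1 then sigma ((i, j), right_step) :: horizontals i (j + 1) l' sigma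
  else [::].

Lemma size_horizontals i j l sigma : size (horizontals i j l sigma) = l.
Proof. by elim: l j => //= l IH j; rewrite IH. Qed.

Lemma eq_horizontals i j l sigma sigma' :
  (forall p s, p.1 = i -> sigma' (p, s) = sigma (p, s)) ->
  horizontals i j l sigma' = horizontals i j l sigma.
Proof. by move=> Es; elim: l j => //= l IH j; rewrite IH !Es. Qed.

Lemma horizontals_unoccupied (i j : int) l sigma :
  reflect (forall a, j <= a < j + l%:Z -> ~~ sigma ((i, a), right_step))
    (all negb (horizontals i j l sigma)).
Proof.
elim: l j => [|l IH] j /=; first by left; lia.
apply: (iffP andP) => [[s_j /IH s_l] a al|s_l].
  by have [->//|] := eqVneq a j; move=> ?; apply: s_l; lia.
by split; [apply: s_l; lia | apply/IH => a al; apply: s_l; lia].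
Qed.

Variable top : int.

Lemma sweep_column6V (i j : int) l sts Phi sigma :
  0 < j -> j + l%:Z = top + 1 ->
  (forall sigma', (forall e : edge, e.1 \notin column i j l -> sigma' e = sigma e) ->
     sweep sts sigma' = Phi (horizontals i j l sigma')) ->
  sweep (map (vertex_step square_steps local6V) (column i j l)
           ++ top_step K top i :: sts) sigma =
  column6V w1 w3 (alternate (~~ odd `|j|%N) l) false
    (~~ sigma ((i, j - 1), up_step)) Phi (horizontals (i - 1) j l sigma).
Proof.
elim: l j Phi sigma => [|l IH] j Phi sigma j_gt0 jl sts_Phi.
  rewrite /= sts_Phi //; have -> : j - 1 = top by lia.
  by congr (_ * _); case: (sigma _).
rewrite [column _ _ _]/= [LHS]/= [RHS]/= exchange_big [RHS]sum_bool.
rewrite [LHS]sum_bool addrC.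
have cell r u :
  let s := update (update sigma (i, j, right_step) r) (i, j, up_step) u in
  local6V (i, j) s * sweep (map (vertex_step square_steps local6V)
    (column i (j + 1) l) ++ top_step K top i :: sts) s =
  vertex_weight (wline w1 w3 (~~ odd `|j|%N)) (sigma ((i - 1, j), right_step)) r
    (~~ u) (~~ sigma ((i, j - 1), up_step))
  * column6V w1 w3 (alternate (~~ ~~ odd `|j|%N) l) false (~~ u)
      (fun v => Phi (r :: v)) (horizontals (i - 1) (j + 1) l sigma).
  move=> s.
  have s_other p q : p != (i, j) -> s (p, q) = sigma (p, q).
    by move=> /negPf ne; rewrite /s /update !xpair_eqE ne.
  have s_right : s ((i, j), right_step) = r by rewrite /s /update !xpair_eqE !eqxx.
  have s_up : s ((i, j), up_step) = u by rewrite /s /update !xpair_eqE !eqxx.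
  congr (_ * _).
    rewrite /local6V s_right s_up sub_right sub_up /wline if_neg.
    by rewrite !s_other // xpair_eqE; lia.
  rewrite (IH _ (fun v => Phi (r :: v))); first last.
  - move=> s' s'E; rewrite sts_Phi /=.
      by rewrite !s'E ?s_right // mem_column; lia.
    by move=> [p q]; rewrite in_cons negb_or => /andP[ne e_in]; rewrite s'E // s_other.
  - by lia.
  - by lia.
  rewrite addrK s_up; have -> : odd `|(j + 1)%R|%N = ~~ odd `|j|%N by lia.
  congr column6V; apply: eq_horizontals => p q pi.
  by rewrite s_other //; apply/eqP => pE; move: pi; rewrite pE /=; lia.
by rewrite !sum_bool !cell /=; ring.
Qed.

Lemma sweep_mixed_rows m (i : int) l (T : pred (edge -> bool)) sigma :
  l%:Z = top ->
  (forall s, T s = all negb (horizontals (i + m%:Z - 1) 1 l s)) ->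
  (forall a, i <= a < i + m%:Z -> sigma ((a, 0), up_step) = false) ->
  sweep (column_steps square_steps local6V top false i 1 l m
           ++ [:: ([::], fun s : edge -> bool => (T s)%:R)]) sigma =
  mixed_rows w1 w3 m (alternate false l) (horizontals (i - 1) 1 l sigma).
Proof.
elim: m i sigma => [|m IH] i sigma lt ET bnd.
  by rewrite /= mulr1 ET addr0.
rewrite [column_steps _ _ _ _ _ _ _ _]/= -catA.
rewrite (sweep_column6V (Phi := mixed_rows w1 w3 m (alternate false l))) //.
- by rewrite /= subrr bnd //=; lia.
- by rewrite addrC lt.
move=> s' s'E; rewrite addn0 subr0 IH ?addrK //.
- by move=> s; rewrite ET; congr (all _ (horizontals _ _ _ _)); lia.
- by move=> a ai; rewrite s'E ?mem_column ?bnd //; lia.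
Qed.

End MixedSide.

(** * The two domains *)

Lemma add_right (i j : int) : ((i, j) : lattice_point) + right_step = (i + 1, j).
Proof. by congr (_, _); rewrite /= addr0. Qed.

Lemma add_up (i j : int) : ((i, j) : lattice_point) + up_step = (i, j + 1).
Proof. by congr (_, _); rewrite /= addr0. Qed.

Lemma add_diag (i j : int) : ((i, j) : lattice_point) + diag_step = (i + 1, j - 1).
Proof. by []. Qed.

Lemma boundary_forward_out V out (p s : lattice_point) : p \notin V ->
  boundary_forward V out (p, s) = ~~ out (p + s) p.
Proof. by rewrite /boundary_forward /= => /negPf ->. Qed.

Lemma boundary_forward_in V out (p s : lattice_point) : p \in V ->
  boundary_forward V out (p, s) = out p (p + s).
Proof. by rewrite /boundary_forward /= => ->. Qed.

Lemma prod_natr_bool (K : comNzRingType) (T : Type) (r : seq T) (b : pred T) :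
  \prod_(v <- r) (b v)%:R = (all b r)%:R :> K.
Proof.
elim: r => [|v r IH]; first by rewrite big_nil.
by rewrite big_cons IH /= -natrM mulnb.
Qed.

Lemma sum_sig (K : nmodType) (T : finType) (P : pred T) (F : T -> K) :
  \sum_(y : {x : T | P x}) F (val y) = \sum_(x : T | P x) F x.
Proof.
rewrite [RHS](@reindex_omap _ _ _ _ {x : T | P x} val insub) => [|x Px];
  last by rewrite insubT.
by apply: eq_bigl => y; rewrite (valP y) valK eqxx.
Qed.

Section Domains.
Variables (n : nat) (k : n.-tuple nat).
Hypotheses (n_gt0 : (0 < n)%N) (k_last_gt0 : (0 < k_last k)%N).
Let kn := k_last k.

Lemma mem_domain20V : domain20V k =i vertices true 1 1 kn n.
Proof. by move=> [a b]; rewrite in_domain20V mem_vertices /kn; lia. Qed.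

Lemma mem_domain_mixed6V :
  domain_mixed6V k =i vertices false 1 1 (2 * kn - 1) n.
Proof. by move=> [a b]; rewrite in_domain_mixed6V mem_vertices /kn; lia. Qed.

Let bnd20V := boundary_forward (domain20V k) (out20V k).
Let bnd6V := boundary_forward (domain_mixed6V k) (out_mixed6V k).

(** The edges issued from the points just below and just above the domain have the
value [false]: those that end in the domain are outgoing boundary edges. *)
Lemma boundary20V_unoccupied (p s : lattice_point) :
  1 <= p.1 < 1 + n%:Z -> (p.1 + p.2 == 1 + 1 - 1) || (p.2 == kn%:Z + 1) ->
  bnd20V (p, s) = false.
Proof.
case: p => a b /= an b_out; rewrite /bnd20V boundary_forward_out; last first.
  by rewrite in_domain20V -/kn; lia.
rewrite /out20V -/kn /=; case: (b == _) => //.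
have -> : (a == n%:Z + 1) = false by lia.
by have -> : (a == 0) = false by lia.
Qed.

Lemma boundary20V_east (i j j' : int) s :
  (i, j) \in domain20V k -> (i, j) + s = (n%:Z + 1, j') -> j' <= kn%:Z ->
  bnd20V ((i, j), s) = false.
Proof.
move=> ijV ijs js; rewrite /bnd20V boundary_forward_in // /out20V ijs -/kn /= eqxx.
by have -> : (j' == kn%:Z + 1) = false by lia.
Qed.

Lemma boundary20V_north (i j : int) :
  (i, j) \in domain20V k -> j = kn%:Z -> bnd20V ((i, j), up_step).
Proof.
move=> ijV jk; rewrite /bnd20V boundary_forward_in // /out20V add_up -/kn /=.
by rewrite jk eqxx.
Qed.

(** The boundary edges that start inside the domain are the topmost vertical edges
and the edges that leave the last column. *)
Lemma boundary20V sigma :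
  let L := [seq (v, s) | v <- vertices true 1 1 kn n, s <- triangular_steps] in
  (forall e, e \notin L -> sigma e = bnd20V e) ->
  all (fun e => (e.1 + e.2 \in domain20V k) || (sigma e == bnd20V e)) L =
  top_outgoing kn 1 n sigma &&
  all negb (entering (1 + n%:Z) (1 - n%:Z) (kn + n) sigma).
Proof.
move=> L sigma_bnd.
have inL i j s : ((i, j), s) \in L =
    ((i, j) \in domain20V k) && (s \in triangular_steps).
  apply/allpairsP/andP => [[[v s'] /= [vV sS [-> ->]]]|[vV sS]].
    by rewrite mem_domain20V.
  by exists ((i, j), s); rewrite -mem_domain20V.
apply/allP/andP => [L_ok|[/top_outgoingP s_top /entering_unoccupied s_east]].
  have L_bnd i j s : (i, j) \in domain20V k -> s \in triangular_steps ->
      (i, j) + s \notin domain20V k -> sigma ((i, j), s) = bnd20V ((i, j), s).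
    move=> vV sS vsV; apply/eqP; have := L_ok ((i, j), s).
    by rewrite inL vV sS /= (negPf vsV); apply.
  split.
    apply/top_outgoingP => a an; have aV : (a, kn%:Z) \in domain20V k.
      by rewrite in_domain20V -/kn; lia.
    by rewrite L_bnd ?boundary20V_north // add_up in_domain20V -/kn; lia.
  apply/entering_unoccupied => a; have -> : 1 + n%:Z - 1 = n%:Z by lia.
  move=> an; apply/andP; split.
    have [aV|aV] := boolP ((n%:Z, a) \in domain20V k); last first.
      rewrite sigma_bnd ?inL ?(negPf aV) // boundary20V_unoccupied //=.
        by lia.
      by move: aV; rewrite in_domain20V -/kn; lia.
    rewrite L_bnd //; last by rewrite add_right in_domain20V -/kn; lia.
    by rewrite (boundary20V_east (j' := a)) ?add_right //; lia.
  have [aV|aV] := boolP ((n%:Z, a + 1) \in domain20V k); last first.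
    rewrite sigma_bnd ?inL ?(negPf aV) // boundary20V_unoccupied //=.
      by lia.
    by move: aV; rewrite in_domain20V -/kn; lia.
  rewrite L_bnd //; last by rewrite add_diag in_domain20V -/kn; lia.
  by rewrite (boundary20V_east (j' := a)) ?add_diag ?addrK //; lia.
move=> [[i j] s]; rewrite inL => /andP[vV sS] /=.
rewrite -implyNb; apply/implyP => vsV; apply/eqP.
move: (vV); rewrite in_domain20V -/kn => ijV.
move: sS; rewrite !inE => /or3P[]/eqP sE; move: vsV; rewrite sE.
- rewrite add_right in_domain20V -/kn => ijV'; have iE : i = n%:Z by lia.
  have /andP[/negPf] := s_east j ltac:(lia).
  have -> : 1 + n%:Z - 1 = i by lia.
  by move=> -> _; rewrite (boundary20V_east (j' := j) vV) ?add_right ?iE //; lia.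
- rewrite add_up in_domain20V -/kn => ijV'; have jE : j = kn%:Z by lia.
  by rewrite boundary20V_north // jE s_top //; lia.
- rewrite add_diag in_domain20V -/kn => ijV'; have iE : i = n%:Z by lia.
  have /andP[_ /negPf] := s_east (j - 1) ltac:(lia).
  have -> : 1 + n%:Z - 1 = i by lia.
  by rewrite subrK => ->; rewrite (boundary20V_east (j' := j - 1) vV) ?add_diag ?iE //; lia.
Qed.

Variable K : comNzRingType.

Lemma balanced20V (o : orientation triangular_steps (domain20V k)) :
  (balanced (out20V k) 3 o)%:R =
  \prod_(v <- domain20V k) local20V K v (forward (out20V k) o).
Proof.
have -> : balanced (out20V k) 3 o =
    all (fun v => (indegree (out20V k) o v == 3) && (outdegree (out20V k) o v == 3))
      (domain20V k).
  apply/forallP/allP => [ok v vV|ok v]; first exact: (ok [` vV]%fset).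
  exact/ok/valP.
rewrite -prod_natr_bool; apply: eq_bigr => v _.
rewrite /local20V /weight20V /indegree /outdegree /=; congr (_%:R).
do 6![case: (forward _ _ _)] => //.
Qed.

Lemma card_config20V :
  #|config20V k|%:R = rows20V K n kn (entering 1 1 kn bnd20V).
Proof.
have -> : #|config20V k|%:R = \sum_(o : orientation triangular_steps (domain20V k))
    (balanced (out20V k) 3 o)%:R :> K.
  rewrite card_sig -sum1_card natr_sum big_mkcond /=.
  by apply: eq_bigr => o _; rewrite inE; case: (balanced _ _ _).
under eq_bigr => o _ do rewrite balanced20V.
rewrite (@sum_orientations_sweep _ _ _ kn%:Z true _ _ _ _ 1 1 kn n
  (fun s => all negb (entering (1 + n%:Z) (1 - n%:Z) (kn + n) s))) //.
- rewrite sweep_rows20V //; first by rewrite addrC.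
  by move=> p s; apply: boundary20V_unoccupied.
- exact: local20V_update.
- exact: mem_domain20V.
- exact: boundary20V.
Qed.

End Domains.

Section MixedDomain.
Variables (n : nat) (k : n.-tuple nat).
Hypotheses (n_gt0 : (0 < n)%N) (k_last_gt0 : (0 < k_last k)%N).
Let kn := k_last k.
Let bnd20V := boundary_forward (domain20V k) (out20V k).
Let bnd6V := boundary_forward (domain_mixed6V k) (out_mixed6V k).

Lemma boundary6V sigma :
  let L := [seq (v, s) | v <- vertices false 1 1 (2 * kn - 1) n, s <- square_steps] in
  (forall e, e \notin L -> sigma e = bnd6V e) ->
  all (fun e => (e.1 + e.2 \in domain_mixed6V k) || (sigma e == bnd6V e)) L =
  top_outgoing (2 * kn - 1)%N 1 n sigma &&
  all negb (horizontals (1 + n%:Z - 1) 1 (2 * kn - 1) sigma).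
Proof.
move=> L _.
have inL i j s : ((i, j), s) \in L =
    ((i, j) \in domain_mixed6V k) && (s \in square_steps).
  apply/allpairsP/andP => [[[v s'] /= [vV sS [-> ->]]]|[vV sS]].
    by rewrite mem_domain_mixed6V.
  by exists ((i, j), s); rewrite -mem_domain_mixed6V.
have bnd_east j : (n%:Z, j) \in domain_mixed6V k ->
    bnd6V ((n%:Z, j), right_step) = false.
  move=> vV; rewrite /bnd6V boundary_forward_in // add_right /out_mixed6V /=.
  by rewrite eqxx.
have bnd_north i j : (i, j) \in domain_mixed6V k -> bnd6V ((i, j), up_step) = true.
  move=> vV; rewrite /bnd6V boundary_forward_in // add_up /out_mixed6V /=.
  move: vV; rewrite in_domain_mixed6V => ijV.
  have -> : (i == n%:Z + 1) = false by lia.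
  by have -> : (i == 0) = false by lia.
have -> : 1 + n%:Z - 1 = n%:Z by lia.
apply/allP/andP => [L_ok|[/top_outgoingP s_top /horizontals_unoccupied s_east]].
  have L_bnd i j s : (i, j) \in domain_mixed6V k -> s \in square_steps ->
      (i, j) + s \notin domain_mixed6V k -> sigma ((i, j), s) = bnd6V ((i, j), s).
    move=> vV sS vsV; apply/eqP; have := L_ok ((i, j), s).
    by rewrite inL vV sS /= (negPf vsV); apply.
  split.
    apply/top_outgoingP => a an.
    have aV : (a, (2 * kn - 1)%N%:Z) \in domain_mixed6V k.
      by rewrite in_domain_mixed6V -/kn; lia.
    by rewrite L_bnd ?bnd_north // add_up in_domain_mixed6V -/kn; lia.
  apply/horizontals_unoccupied => a an.
  have aV : (n%:Z, a) \in domain_mixed6V k by rewrite in_domain_mixed6V -/kn; lia.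
  by rewrite L_bnd ?bnd_east // add_right in_domain_mixed6V -/kn; lia.
move=> [[i j] s]; rewrite inL => /andP[vV sS] /=.
rewrite -implyNb; apply/implyP => vsV; apply/eqP.
move: (vV); rewrite in_domain_mixed6V -/kn => ijV.
move: sS; rewrite !inE => /orP[]/eqP sE; move: vsV; rewrite sE.
- rewrite add_right in_domain_mixed6V -/kn => ijV'; have iE : i = n%:Z by lia.
  rewrite iE in vV *; rewrite bnd_east //; apply/negbTE/s_east; lia.
- rewrite add_up in_domain_mixed6V -/kn => ijV'.
  have jE : j = (2 * kn - 1)%N%:Z by lia.
  by rewrite jE in vV *; rewrite bnd_north // s_top //; lia.
Qed.

Lemma sum_mixed6V (K : comNzRingType) (w1 w3 : weights6V K) :
  \sum_(o : orientation square_steps (domain_mixed6V k))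
    \prod_(v <- domain_mixed6V k) local6V w1 w3 v (forward (out_mixed6V k) o) =
  mixed_rows w1 w3 n (alternate false (2 * kn - 1))
    (horizontals 0 1 (2 * kn - 1) bnd6V).
Proof.
rewrite (@sum_orientations_sweep _ _ _ (2 * kn - 1)%N%:Z false _ _ _ _
  1 1 (2 * kn - 1) n
  (fun s => all negb (horizontals (1 + n%:Z - 1) 1 (2 * kn - 1) s))) //.
- rewrite sweep_mixed_rows //.
  move=> a an; rewrite boundary_forward_out ?in_domain_mixed6V; last by lia.
  rewrite add_up /out_mixed6V /=.
  have -> : (a == n%:Z + 1) = false by lia.
  by have -> : (a == 0) = false by lia.
- by move=> s; rewrite !inE => /orP[]->; rewrite ?orbT.
- exact: local6V_update.
- exact: mem_domain_mixed6V.
- exact: boundary6V.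
Qed.

Lemma entering_horizontals l (j : int) (s s' : edge -> bool) :
  (forall a, j <= a < j + l.+1%:Z ->
     [/\ s ((0, a), right_step) = s' ((0, 2 * a - 1), right_step),
         s ((0, a + 1), diag_step) = false
       & s' ((0, 2 * a), right_step) = false]) ->
  entering 1 j l.+1 s = rcons (horizontals 0 (2 * j - 1) l.*2.+1 s') false.
Proof.
elim: l j => [|l IH] j s_s'.
  have [|sj sj' _] := s_s' j; first by lia.
  by rewrite /= subrr sj sj'.
have [|sj sj' s'j] := s_s' j; first by lia.
rewrite doubleS -[entering _ _ _ _]/[:: s ((0, j), right_step),
  s ((0, j + 1), diag_step) & entering 1 (j + 1) l.+1 s].
rewrite IH => [|a aj]; last by apply: s_s'; lia.
have -> : horizontals 0 (2 * j - 1) l.*2.+3 s' =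
  [:: s' ((0, 2 * j - 1), right_step), s' ((0, 2 * j), right_step)
    & horizontals 0 (2 * (j + 1) - 1) l.*2.+1 s'].
  have -> : 2 * (j + 1) - 1 = 2 * j - 1 + 1 + 1 by lia.
  by rewrite /= subrK.
by rewrite sj sj' s'j.
Qed.

(** Row [2 j - 1] of the mixed domain is the horizontal line [j] of the 20V domain and
row [2 j] is the diagonal line between the horizontal lines [j] and [j + 1]; the
last diagonal line remains. *)
Lemma initial_states :
  entering 1 1 kn bnd20V = rcons (horizontals 0 1 (2 * kn - 1) bnd6V) false.
Proof.
have knE : kn = kn.-1.+1 by lia.
have -> : (2 * kn - 1)%N = kn.-1.*2.+1 by lia.
rewrite {1}knE; apply: entering_horizontals => a ak.
have notin20 b : (0, b) \notin domain20V k by rewrite in_domain20V; lia.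
have notin6 b : (0, b) \notin domain_mixed6V k by rewrite in_domain_mixed6V; lia.
have n_neq : (0 == n%:Z + 1) = false by lia.
rewrite /bnd20V /bnd6V !boundary_forward_out // !add_right add_diag.
rewrite /out20V /out_mixed6V -/kn /= n_neq ?eqxx ?negbK ?addrK ?eqxx /=.
split.
- have -> : (a == kn%:Z + 1) = false by lia.
  rewrite negbK; apply/mapP/mapP => -[l lk aE]; exists l => //; lia.
- case: (_ == _) => //.
  by have -> : (a + 1 == a) = false by lia.
- by apply/negbTE/mapP => -[l lk]; lia.
Qed.

End MixedDomain.

(** * Probabilistic bijections and positivity *)

Lemma probabilistic_bijection_of_sum (K : numFieldType) (X Y : finType)
    (omega : Y -> K) :
  \sum_(y : Y) omega y = #|X|%:R -> (#|X| = 0 -> #|Y| = 0)%N ->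
  exists P Pbar : X -> Y -> K,
    probabilistic_bijection (fun _ : X => 1) omega P Pbar.
Proof.
move=> sum_omega Y0.
exists (fun _ y => omega y / #|X|%:R), (fun _ _ => #|X|%:R^-1).
have [X0|X_neq0] := eqVneq #|X| 0%N.
  split=> [x|y|x y]; last by rewrite mul1r mulrC.
    by have := card0_eq X0 x.
  by have := card0_eq (Y0 X0) y.
have XK : #|X|%:R != 0 :> K by rewrite pnatr_eq0.
split=> [x|y|x y]; last by rewrite mul1r mulrC.
  by rewrite -mulr_suml sum_omega divff.
by rewrite sumr_const -[RHS](divff XK) mulr_natl.
Qed.

Lemma vertex_weight_gt0 (K : numDomainType) (w : weights6V K) (l r t b : bool) :
  0 < wa w -> 0 < wb w -> 0 < wc w -> (l + t = r + b)%N ->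
  0 < vertex_weight w l r t b.
Proof. by case: l; case: r; case: t; case: b. Qed.

Lemma vertex_weight_eq0 (K : pzRingType) (w : weights6V K) (l r t b : bool) :
  (l + t != r + b)%N -> vertex_weight w l r t b = 0.
Proof. by case: l; case: r; case: t; case: b. Qed.

Lemma vertex_weight_scale (K : comNzRingType) (c x y z : K) (l r t b : bool) :
  vertex_weight (Weights6V (c * x) (c * y) (c * z)) l r t b =
  c * vertex_weight (Weights6V x y z) l r t b.
Proof. by case: l; case: r; case: t; case: b; rewrite /= ?mulr0. Qed.

Section Balanced6V.
Variables (n : nat) (k : n.-tuple nat).
Let out := out_mixed6V k.
Implicit Type o : orientation square_steps (domain_mixed6V k).

Lemma balanced6V o (fwd := forward out o) :
  balanced out 2 o =
  all (fun v : lattice_point =>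
      (fwd ((v - right_step)%R, right_step) + ~~ fwd (v, up_step))%N ==
      (fwd (v, right_step) + ~~ fwd ((v - up_step)%R, up_step))%N)
    (domain_mixed6V k).
Proof.
apply/forallP/allP => [ok v vV|ok v].
  have := ok [` vV]%fset; rewrite /indegree /outdegree /= /fwd.
  by do 4![case: (forward _ _ _)].
have := ok _ (valP v); rewrite /indegree /outdegree /= /fwd.
by do 4![case: (forward _ _ _)].
Qed.

Lemma unbalanced6V (K : comNzRingType) (w1 w3 : weights6V K) o :
  ~~ balanced out 2 o ->
  \prod_(v <- domain_mixed6V k) local6V w1 w3 v (forward out o) = 0.
Proof.
rewrite balanced6V => /allPn[v vV v_bad].
by rewrite (bigD1_seq v) ?fset_uniq //= /local6V vertex_weight_eq0 ?mul0r.
Qed.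

Lemma balanced6V_gt0 (K : numDomainType) (a b : K) o (w1 := Weights6V a b a)
    (w3 := Weights6V b a a) :
  0 < a -> 0 < b -> balanced out 2 o ->
  0 < \prod_(v <- domain_mixed6V k) local6V w1 w3 v (forward out o).
Proof.
move=> a_gt0 b_gt0; rewrite balanced6V => /allP o_ok.
rewrite big_seq; apply: prodr_gt0 => v /o_ok /eqP v_ok.
by rewrite /local6V; case: ifP => _; apply: vertex_weight_gt0.
Qed.

End Balanced6V.

(** * The weights of the statement *)

Section SpecialPoint.
Variable R : realType.
Let al : R[i] := two_pow (- (1 / 3)).
Let be : R[i] := two_pow (1 / 6).

Lemma two_powD (x y : R) : two_pow (x + y) = two_pow x * two_pow y.
Proof.
by rewrite /two_pow -rmorphM powRD // pnatr_eq0 implybT.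
Qed.

Lemma two_pow_gt0 (x : R) : 0 < two_pow x.
Proof. by rewrite /two_pow ltcR powR_gt0 // ltr0n. Qed.

Lemma two_pow_abb : al * be * be = 1.
Proof.
rewrite -!two_powD; have -> : - (1 / 3) + 1 / 6 + 1 / 6 = 0 :> R by field.
by rewrite /two_pow powRr0.
Qed.

Lemma two_pow_aaa : al * al * al + al * al * al = 1.
Proof.
rewrite -!two_powD; have -> : - (1 / 3) + - (1 / 3) + - (1 / 3) = - 1 :> R by field.
rewrite /two_pow powRN powRr1 ?ler0n // -rmorphD /=.
by have -> : 2^-1 + 2^-1 = 1 :> R by field.
Qed.

Lemma root16_neq0 : root16 R != 0.
Proof.
apply/eqP => root0; have := cos2Dsin2 (pi / 8 : R).
move: root0 => /eqP; rewrite eq_complex /= => /andP[/eqP-> /eqP->].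
by rewrite expr0n addr0 => /eqP; rewrite eq_sym oner_eq0.
Qed.

Lemma root16_cube : root16 R ^+ 3 * root16 R ^- 3 = 1.
Proof. by rewrite divff // expf_neq0 // root16_neq0. Qed.

End SpecialPoint.

Theorem proposition3p7 (R : realType) (n : nat) (n_ge1 : (1 <= n)%N)
    (k : n.-tuple nat) (k_gt0 : forall i : 'I_n, (0 < tnth k i)%N)
    (k_incr : forall i j : 'I_n, (i < j)%N -> (tnth k i < tnth k j)%N) :
  exists P Pbar : config20V k -> config_mixed6V k -> R[i],
    probabilistic_bijection
      (fun _ : config20V k => 1)
      (fun x : config_mixed6V k => prefactor R k * weight_mixed6V R x)
      P Pbar.
Proof.
have k_last_gt0 : (0 < k_last k)%N.
  have /tnthP[i ->] : k_last k \in k; last exact: k_gt0.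
  rewrite memtE /k_last; case: (tval k) (size_tuple k) => [|x s _]; last exact: mem_last.
  by move=> n0; rewrite -n0 in n_ge1.
pose al : R[i] := two_pow (- (1 / 3)); pose be : R[i] := two_pow (1 / 6).
have total : \sum_(x : config_mixed6V k) prefactor R k * weight_mixed6V R x =
    #|config20V k|%:R.
  rewrite -mulr_sumr.
  have -> : \sum_(x : config_mixed6V k) weight_mixed6V R x =
      \sum_(o : orientation square_steps (domain_mixed6V k))
        \prod_(v <- domain_mixed6V k)
          local6V (weights1 R) (weights3 R) v (forward (out_mixed6V k) o).
    rewrite (sum_sig _ (fun o => \prod_(v <- domain_mixed6V k)
      local6V (weights1 R) (weights3 R) v (forward (out_mixed6V k) o))).
    rewrite big_mkcond; apply: eq_bigr => o _; case: ifPn => // o_bad.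
    by rewrite unbalanced6V.
  rewrite sum_mixed6V // card_config20V // initial_states //.
  have knE : k_last k = (k_last k).-1.+1 by lia.
  have -> : (2 * k_last k - 1)%N = (k_last k).-1.*2.+1 by lia.
  rewrite [X in rows20V _ _ X _]knE.
  rewrite (rows20V_mixed_rows (w1 := weights1 R) (w2 := weights2 R)
    (w3 := weights3 R)) ?size_horizontals //.
  - by rewrite -knE /prefactor; ring.
  - exact: triangle_before (root16_cube R) (two_pow_abb R) (two_pow_aaa R).
  - exact: triangle_after (root16_cube R) (two_pow_abb R) (two_pow_aaa R).
apply: probabilistic_bijection_of_sum => // X0.
(* If there is no 20V configuration, the total weight of the mixed configurations
   is 0; their common phase factors out of it and leaves a sum of positive terms. *)
pose phase : R[i] := \prod_(v <- domain_mixed6V k)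
  (if odd `|v.2|%N then 1 else root16 R ^- 3).
pose modulus (x : config_mixed6V k) : R[i] := \prod_(v <- domain_mixed6V k)
  local6V (Weights6V al be al) (Weights6V be al al) v
    (forward (out_mixed6V k) (val x)).
have weightE x : weight_mixed6V R x = phase * modulus x.
  rewrite -big_split; apply: eq_bigr => v _; rewrite /local6V /=.
  by case: ifP => _; rewrite ?mul1r // -vertex_weight_scale.
have modulus_gt0 x : 0 < modulus x.
  by apply: balanced6V_gt0 (two_pow_gt0 _) (two_pow_gt0 _) (valP x).
have phase_neq0 : prefactor R k * phase != 0.
  have nz := root16_neq0 R.
  have nz2 (x : R) : two_pow x != 0 by rewrite gt_eqF ?two_pow_gt0.
  apply: mulf_neq0.
    by rewrite /prefactor /= !(mulf_neq0, expf_neq0, invr_neq0) //; exact: nz2.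
  rewrite prodf_seq_neq0; apply/allP => v _; apply/implyP => _.
  by case: ifP; rewrite ?oner_neq0 ?invr_neq0 ?expf_neq0.
move: total; rewrite X0; under eq_bigr do rewrite weightE mulrA.
rewrite -mulr_sumr => /eqP; rewrite mulf_eq0 (negPf phase_neq0) /= => /eqP sum0.
apply: eq_card0 => x; apply/negP => _.
have := psumr_eq0P (fun y _ => ltW (modulus_gt0 y)) sum0 (i := x) isT.
by move/eqP; rewrite gt_eqF.
Qed.
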